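(* Let $X$ be a Fort space with particular point $b$ and let $(X,S)$ be a transformation group. Let $\alpha$ be the cardinality of $\{xS: x\in X\text{ is a minimal point}\}\setminus\{bS\}$ and let $\beta$ be the cardinality of $\{xS: x\in X\text{ is a non-minimal point}\}\cup\{bS\}$. Then the indicator topological space of $(X,S)$ is homeomorphic to the disjoint union (topological sum) of $Y_\alpha$ and $Z_\beta$, where $Y_\alpha$ is the set $\alpha$ with the discrete topology and $Z_\beta$ is the set $\beta$ with the topology $\{U\subseteq\beta: 0\in U\}\cup\{\varnothing\}$.
   Context: A transformation group $(Y,S)$ consists of a (nonempty) compact Hausdorff space $Y$, a discrete group $S$ with identity $e$, and a continuous map $Y\times S\to Y$, $(x,s)\mapsto xs$, with $xe=x$ and $x(st)=(xs)t$ for all $x\in Y$, $s,t\in S$. Write $xS=\{xs:s\in S\}$. A nonempty subset $Z\subseteq Y$ is invariant if $zs\in Z$ for all $z\in Z$, $s\in S$. A point $x\in Y$ is minimal if $\overline{xS}$ contains no nonempty closed invariant proper subset, and non-minimal otherwise. The indicator topological space of $(Y,S)$ is the set $\{\overline{xS}:x\in Y\}$ with the topology having as a basis the collection of sets $\{\overline{yS}: y\in\overline{xS}\}$, $x\in Y$. A Fort space with particular point $b\in X$ is a set $X$ with the topology $\{U\subseteq X: b\notin U\text{ or }X\setminus U\text{ is finite}\}$ ($X$ may be finite or infinite). Cardinals are identified with initial ordinals, so that a nonzero cardinal $\beta$ is a set having $0$ as an element. *)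

(* Defs.v *)
From HB Require Import structures.
From mathcomp Require Import all_boot.
From mathcomp Require Import all_classical.
From mathcomp Require wochoice.
From mathcomp Require Import topology.

Set Implicit Arguments.
Unset Strict Implicit.
Unset Printing Implicit Defensive.

Local Open Scope classical_set_scope.
Local Open Scope card_scope.

Record transformation_group (Y : topologicalType) (S : groupType) := {
  tg_act :> Y -> S -> Y;
  tg_nonempty : [set: Y] !=set0;
  tg_compact : compact [set: Y];
  tg_hausdorff : hausdorff_space Y;
  tg_continuous :
    continuous (fun p : Y * discrete_topology S => tg_act p.1 p.2);
  tg_act1 : forall x, tg_act x 1%g = x;
  tg_actM : forall x s t, tg_act x (s * t)%g = tg_act (tg_act x s) t
}.

Section Orbits.
Context (Y : topologicalType) (S : groupType) (a : transformation_group Y S).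

Definition tg_orbit (x : Y) : set Y := [set a x s | s in [set: S]].

Definition invariant_set (Z : set Y) := forall z s, Z z -> Z (a z s).

Definition minimal_point (x : Y) :=
  ~ exists Z : set Y,
      [/\ Z !=set0, closed Z, invariant_set Z & Z `<` closure (tg_orbit x)].

Lemma act_continuous (s : S) : continuous (a^~ s).
Proof.
move=> x; pose f (y : Y) : Y * discrete_topology S := (y, s).
have fx : {for x, continuous f}.
  move=> B [[U V] /= [xU sV] UVB]; apply: filterS xU => y Uy.
  by apply: UVB; split => //=; exact: (@nbhs_singleton (discrete_topology S)).
exact: (continuous_comp fx (@tg_continuous _ _ a (f x))).
Qed.

Lemma closure_orbit_act (x z : Y) (s : S) :
  closure (tg_orbit x) z -> closure (tg_orbit x) (a z s).
Proof.
move=> xz B /(act_continuous (s := s)) /xz [_ [[t _ <-] Bt]].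
by exists (a x (t * s)%g); split; [exists (t * s)%g|rewrite tg_actM].
Qed.

Lemma closure_orbit_sub (x z : Y) :
  closure (tg_orbit x) z -> closure (tg_orbit z) `<=` closure (tg_orbit x).
Proof.
move=> xz; rewrite [X in _ `<=` X](closure_id _).1; last exact: closed_closure.
by apply: closureS => _ [s _ <-]; exact: closure_orbit_act.
Qed.

Lemma closure_orbit_refl (x : Y) : closure (tg_orbit x) x.
Proof. by apply: subset_closure; exists 1%g => //; exact: tg_act1. Qed.

End Orbits.

Definition indicator_space (Y : topologicalType) (S : groupType)
    (a : transformation_group Y S) : Type :=
  set_type [set closure (tg_orbit a x) | x in [set: Y]].

Section IndicatorTopology.
Context (Y : topologicalType) (S : groupType) (a : transformation_group Y S).
Local Notation I := (indicator_space a).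

Definition indicator_basic (x : Y) : set I :=
  [set p : I | exists2 y, closure (tg_orbit a x) y
                        & set_val p = closure (tg_orbit a y)].

Definition indicator_basis : set (set I) :=
  [set indicator_basic x | x in [set: Y]].

HB.instance Definition _ := Choice.on I.

Let basis_cover : \bigcup_(B in indicator_basis) B = [set: I].
Proof.
apply/seteqP; split => // p _.
have /set_mem [x _ xp] := valP p.
exists (indicator_basic x); first by exists x.
by exists x => //; exact: closure_orbit_refl.
Qed.

Let basis_join (B C : set I) (p : I) :
  indicator_basis B -> indicator_basis C -> B p -> C p ->
  exists D, [/\ indicator_basis D, D p & D `<=` B `&` C].
Proof.
move=> [x _ <-] [x' _ <-] [y xy py] [y' xy' py'].
exists (indicator_basic y); split; first by exists y.
  by exists y => //; exact: closure_orbit_refl.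
move=> q [z yz qz]; split; exists z => //.
  exact: closure_orbit_sub xy _ yz.
by apply: closure_orbit_sub xy' _ _; rewrite -py' py.
Qed.

HB.instance Definition _ :=
  @isBaseTopological.Build I (set I) indicator_basis id basis_cover basis_join.

End IndicatorTopology.

Arguments indicator_basic {Y S} a x _.
Arguments indicator_basis {Y S} a _.

Definition Fort_space (X : topologicalType) (b : X) :=
  forall U : set X, open U <-> (~ U b \/ finite_set (~` U)).

Definition initial_segment (T : eqType) (R : rel T) (x : T) : set T :=
  [set y | R y x /\ y <> x].

(* A cardinal is an initial ordinal: a well-ordered set that is equinumerous to
   none of its proper initial segments, which represent the smaller ordinals.
   [wochoice.well_order] is about the reflexive order relation. *)
Record cardinal := {
  cardinal_sort :> choiceType;
  cardinal_le : rel cardinal_sort;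
  cardinal_wo : wochoice.well_order cardinal_le;
  cardinal_initial :
    forall x, initial_segment cardinal_le x #!= [set: cardinal_sort]
}.

(* The ordinal 0, as an element of a nonzero ordinal, is its least element. *)
Definition is_zero (beta : cardinal) (z : beta) :=
  forall x : beta, cardinal_le z x.

Definition cardinal_discrete (alpha : cardinal) : topologicalType :=
  discrete_topology alpha.

Definition cardinal_particular (beta : cardinal) : Type := beta.

Section ParticularTopology.
Context (beta : cardinal).

Definition particular_open : set (set (cardinal_particular beta)) :=
  [set U | (exists2 z : beta, is_zero z & U z) \/ U = set0].

Lemma ex_zero (x : beta) : exists z : beta, is_zero z.
Proof.
have ne : wochoice.nonempty (predT : {pred beta}) by exists x.
have [z [[_ zmin] _]] := cardinal_wo ne.
by exists z => y; exact: zmin.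
Qed.

Lemma is_zero_uniq (z z' : beta) : is_zero z -> is_zero z' -> z = z'.
Proof.
move=> z0 z0'.
have ne : wochoice.nonempty (predT : {pred beta}) by exists z.
have [t [_ tu]] := cardinal_wo ne.
by rewrite -(tu z) ?(tu z') //; split.
Qed.

Let particular_openT : particular_open setT.
Proof.
have [->|/set0P [x _]] := eqVneq [set: beta] set0; first by right.
by left; have [z z0] := ex_zero x; exists z.
Qed.

Let particular_openI : setI_closed particular_open.
Proof.
move=> U V [[z z0 Uz]|->]; last by right; rewrite set0I.
move=> [[t t0 Vt]|->]; last by right; rewrite setI0.
by left; exists z => //; split => //; rewrite (is_zero_uniq z0 t0).
Qed.

Let particular_open_bigU (I : Type) (f : I -> set (cardinal_particular beta)) :
  (forall i, particular_open (f i)) -> particular_open (\bigcup_i f i).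
Proof.
move=> fo; have [[i [z z0 fz]]|nz] :=
  pselect (exists i, exists2 z : beta, is_zero z & f i z).
  by left; exists z => //; exists i.
by right; apply: bigcup0 => i _; case: (fo i) => // zi; case: nz; exists i.
Qed.

HB.instance Definition _ := Choice.copy (cardinal_particular beta) beta.
HB.instance Definition _ := isOpenTopological.Build (cardinal_particular beta)
  particular_openT particular_openI particular_open_bigU.

End ParticularTopology.

Definition topological_sum (Y Z : topologicalType) : topologicalType :=
  {i : bool & (if i then Y else Z)}.

Definition homeomorphic (Y Z : topologicalType) :=
  exists (f : Y -> Z) (g : Z -> Y),
    [/\ cancel f g, cancel g f, continuous f & continuous g].

Lemma cardinal_exists (T : choiceType) (A : set T) :
  exists alpha : cardinal, [set: alpha] #= A.
Proof.
pose W : choiceType := set_type A.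
have WA : [set: W] #= A by exact: card_setT.
have [R Rwo] := wochoice.well_ordering_principle W.
have minP (P : {pred W}) x : x \in P ->
    exists2 z, z \in P & forall y, y \in P -> R z y.
  by move=> Px; have [|z [[zP zmin] _]] := Rwo P; [exists x|exists z].
have Rch : {in (predT : {pred W}) &, total R}.
  apply: wochoice.wo_chainW; exact: wochoice.withinW Rwo.
have Ranti x y : R x y -> R y x -> x = y.
  move=> xy yx; pose P : {pred W} := pred2 x y.
  have Rxx z : R z z by have := Rch z z isT isT; rewrite orbb.
  have [|t [_ tu]] := Rwo P; first by exists x; rewrite inE eqxx.
  rewrite -(tu x) ?(tu y) //; split; rewrite ?inE ?eqxx ?orbT//.
    by move=> z; rewrite inE => /orP[] /eqP ->.
  by move=> z; rewrite inE => /orP[] /eqP ->.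
have Rtr x y z : R x y -> R y z -> R x z.
  move=> xy yz; have [|t] := minP (pred3 x y z) x; first by rewrite inE eqxx.
  rewrite inE => /or3P[] /eqP -> tmin.
  - by apply: tmin; rewrite !inE eqxx !orbT.
  - have yx : R y x by apply: tmin; rewrite inE eqxx.
    by rewrite (Ranti _ _ xy yx).
  - have zy : R z y by apply: tmin; rewrite !inE eqxx orbT.
    by rewrite -(Ranti _ _ yz zy).
have [[x0 x0P]|nP] :=
  pselect (exists x, initial_segment R x #= [set: W]); last first.
  have Rinit x : initial_segment R x #!= [set: W].
    by apply/negP => xW; apply: nP; exists x.
  by exists (Build_cardinal Rwo Rinit).
pose Q : {pred W} := [pred x | initial_segment R x #= [set: W]].
have [|x xP xmin] := minP Q x0; first exact: x0P.
rewrite unfold_in /= in xP.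
pose C : choiceType := set_type (initial_segment R x).
pose RC : rel C := fun u v => R (val u) (val v).
have RCwo : wochoice.well_order RC.
  apply: wochoice.antisymmetric_well_order.
    by move=> u v /andP[uv vu]; apply: val_inj; exact: (Ranti _ _ uv vu).
  move=> P [u uP].
  pose Pw : {pred W} :=
    [pred w | `[< exists2 v : C, v \in P & val v = w >]].
  have uw : val u \in Pw by apply/asboolP; exists u.
  have [z /asboolP[v vP vz] zmin] := minP Pw _ uw.
  exists v; split => // t tP; rewrite /RC vz.
  by apply: zmin; apply/asboolP; exists t.
have RCinit u : initial_segment RC u #!= [set: C].
  apply/negP => uC.
  have [ux unx] := set_mem (valP u).
  apply: unx; apply: (Ranti _ _) => //; apply: xmin; rewrite unfold_in /=.
  apply: (card_eq_trans _ xP).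
  apply: (card_eq_trans _ (card_setT _)).
  apply: (card_eq_trans _ uC).
  have -> : initial_segment R (val u) = val @` initial_segment RC u.
    apply/seteqP; split => [w [wu wnu]|_ [v [vu vnu] <-]].
      have wx : w \in initial_segment R x.
        apply/mem_set; split; first exact: Rtr wu ux.
        by move=> wx; apply: wnu; apply: (Ranti _ _) => //; rewrite wx.
      exists (exist _ w wx) => //; split => // /(congr1 val) /=.
      exact: wnu.
    by split => // /val_inj.
  by apply: inj_card_eq => ? ? _ _; exact: val_inj.
exists (Build_cardinal RCwo RCinit).
exact: (card_eq_trans (card_eq_trans (card_setT _) xP) WA).
Qed.

(* Main.v *)
Require Import Defs.
From mathcomp Require Import all_boot all_classical topology.

(** Let [b] be the particular point. Every set containing [b] is closed, so the
    closure of an orbit [xS] is contained in [xS] together with [b]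
    ([orbit_closure_sub]). Consequently an orbit can be recovered from its
    closure ([orbit_point_eq]), so that the points of the indicator space are
    the orbits. Moreover, a nonempty closed invariant proper subset of the
    closure of [xS] cannot meet [xS], since it would then contain that closure;
    so its only possible element is [b]. Hence the orbit closure of a
    non-minimal point contains [b] ([nonminimal_closure_particular]).

    The least open set around a point of the indicator space is therefore that
    point alone when the orbit is minimal, and that point together with the
    point of [bS] otherwise. So a set of orbits is open exactly when it
    contains [bS] as soon as it contains a non-minimal orbit
    ([open_indicatorE]). Openness puts no constraint on the minimal orbits
    other than [bS]: they form the discrete summand. The non-minimal orbits and
    [bS] form the other summand, with [bS] as particular point.

    The homeomorphism is built from orbit representatives indexed by the two
    cardinals ([card_eq_image_reps]), where the second indexing is adjusted so
    that the ordinal [0] is sent to [bS] ([card_eq_image_reps_at]). *)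

Local Open Scope classical_set_scope.
Local Open Scope card_scope.

(** * Indexing the values of a function by an equinumerous type *)

Lemma card_eq_image_reps {T U : Type} {V : pointedType} {F : U -> V}
    {P : set U} :
  [set: T] #= F @` P ->
  exists r : T -> U,
    [/\ forall i, P (r i), injective (F \o r)
      & forall x, P x -> exists i, F (r i) = F x].
Proof.
move=> /card_set_bijP [f [fimg finj fsurj]].
have [r rP] : {r : T -> U & forall i, P (r i) /\ F (r i) = f i}.
  apply: (@choice _ _ (fun i x => P x /\ F x = f i)) => i.
  by have [x Px Fx] := fimg i I; exists x.
exists r; split=> [i|i j /=|x Px]; first by case: (rP i).
  by rewrite (rP i).2 (rP j).2; apply: finj; exact: in_setT.
have [i _ fi] := fsurj (F x) (ex_intro2 _ _ x Px erefl).
by exists i; rewrite (rP i).2.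
Qed.

(** Any indexing can be made to send a prescribed index to a prescribed value,
    by composing it with a transposition of indices. *)
Lemma card_eq_image_reps_at {T : eqType} {U : Type} {V : pointedType}
    {F : U -> V} {P : set U} {z : T} {u : U} :
  P u -> [set: T] #= F @` P ->
  exists r : T -> U,
    [/\ forall i, P (r i), injective (F \o r),
        forall x, P x -> exists i, F (r i) = F x & F (r z) = F u].
Proof.
move=> Pu /card_eq_image_reps [r [rP rinj rsurj]].
have [j rj] := rsurj u Pu.
pose t i := if i == z then j else if i == j then z else i.
have tK : involutive t.
  move=> i; rewrite /t; have [->|iz] := eqVneq i z.
    by rewrite /=; have [->|_] := eqVneq j z; rewrite ?eqxx.
  by have [->|ij] := eqVneq i j; rewrite ?eqxx // (negbTE iz) (negbTE ij).
exists (r \o t); split=> [i|i i' /rinj /(inv_inj tK) //|x /rsurj [i <-]|].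
- exact: rP.
- by exists (t i); rewrite /comp tK.
- by rewrite /= /t eqxx.
Qed.

(** * Homeomorphisms from open bijections *)

Lemma homeomorphic_from_bij {Y Z : topologicalType} {e : Z -> Y} :
  bijective e -> (forall U : set Y, open U <-> open (e @^-1` U)) ->
  homeomorphic Y Z.
Proof.
move=> [g eK gK] openE; exists g, e; split => //.
  apply/continuousP => A oA; apply/openE.
  by rewrite (_ : _ @^-1` _ = A) //; apply/funext => z; rewrite /preimage /= eK.
by apply/continuousP => A /openE.
Qed.

(** * Orbit closures and least open neighborhoods in the indicator space *)

Section Indicator.
Context {Y : topologicalType} {S : groupType} (a : transformation_group Y S).
Local Notation I := (indicator_space a).

Definition orbit_point (x : Y) : I :=
  exist _ (closure (tg_orbit a x)) (mem_set (imageT _ x)).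

Lemma orbit_point_surj (p : I) : exists x, p = orbit_point x.
Proof.
by have /set_mem [x _ xp] := valP p; exists x; apply: val_inj; rewrite -xp.
Qed.

Lemma orbit_eqP (x y : Y) : tg_orbit a x y <-> tg_orbit a x = tg_orbit a y.
Proof.
split=> [[s _ <-]|->]; last by exists 1%g; rewrite // tg_act1.
apply/seteqP; split => _ [t _ <-].
  by exists (s^-1 * t)%g; rewrite // -tg_actM mulVKg.
by exists (s * t)%g; rewrite // tg_actM.
Qed.

Lemma minimal_point_orbit {x y : Y} :
  tg_orbit a x = tg_orbit a y -> minimal_point a x -> minimal_point a y.
Proof. by rewrite /minimal_point => ->. Qed.

(** An orbit is generated by each of its elements, so one common element of [Z]
    and the orbit is enough. *)
Lemma closure_orbit_sub_closed {Z : set Y} {x y : Y} :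
  closed Z -> invariant_set a Z -> Z y -> tg_orbit a x y ->
  closure (tg_orbit a x) `<=` Z.
Proof.
move=> cZ iZ Zy /orbit_eqP ->; rewrite [X in _ `<=` X](closure_id _).1 //.
by apply: closureS => _ [s _ <-]; exact: iZ.
Qed.

Lemma minimal_closure_orbit {x y : Y} :
  minimal_point a x -> closure (tg_orbit a x) y ->
  closure (tg_orbit a y) = closure (tg_orbit a x).
Proof.
move=> xm xy; apply: contrapT => ne; apply: xm.
exists (closure (tg_orbit a y)); split.
- by exists y; exact: closure_orbit_refl.
- exact: closed_closure.
- by move=> z s; exact: closure_orbit_act.
- split; first exact: closure_orbit_sub.
  move=> sub; apply: ne; apply/seteqP; split => //.
  exact: closure_orbit_sub.
Qed.

(** Belonging to an orbit closure is a transitive relation, so a basic set that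
    contains a point also contains the basic set centered there: the latter is
    the least open neighborhood of that point. *)
Lemma open_indicator_basicP (U : set I) :
  open U <-> forall x, U (orbit_point x) -> indicator_basic a x `<=` U.
Proof.
split=> [[D' D'b <-] x [B D'B]|Usub].
  have [y _ yB] := D'b _ D'B; rewrite -{}yB in D'B *.
  move=> [z yz /= xz] p [w xw pw]; exists (indicator_basic a y) => //=.
  by exists w => //; apply: closure_orbit_sub yz _ _; rewrite -xz.
exists [set indicator_basic a x | x in [set x | U (orbit_point x)]].
  by move=> _ [x _ <-]; exists x.
apply/seteqP; split => [p [_ [x Ux <-]] xp|p Up]; first exact: Usub xp.
have [x px] := orbit_point_surj p; rewrite px in Up *.
exists (indicator_basic a x); first by exists x.
by exists x => //; exact: closure_orbit_refl.
Qed.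

End Indicator.

(** * Orbit closures in a Fort space *)

Section Fort.
Context {X : topologicalType} {b : X} {S : groupType}.
Context (a : transformation_group X S) (Xb : Fort_space b).

Lemma Fort_closed {A : set X} : A b -> closed A.
Proof.
by move=> Ab; rewrite -openC; apply/(Xb _); left => nAb; exact: nAb.
Qed.

Lemma orbit_closure_sub {x : X} :
  closure (tg_orbit a x) `<=` tg_orbit a x `|` [set b].
Proof.
have cl : closed (tg_orbit a x `|` [set b]) by apply: Fort_closed; right.
by rewrite [X in _ `<=` X](closure_id _).1 //; apply: closureS => y; left.
Qed.

(** If the closures agree, each of [x] and [y] lies in the other's orbit or is
    [b]; when neither lies in the other's orbit, both are [b]. *)
Lemma orbit_point_eq {x y : X} :
  orbit_point a x = orbit_point a y <-> tg_orbit a x = tg_orbit a y.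
Proof.
split=> [pxy|xy]; last by apply: val_inj; rewrite /= xy.
have xy : closure (tg_orbit a x) = closure (tg_orbit a y) :=
  congr1 set_val pxy.
have /orbit_closure_sub : closure (tg_orbit a y) x.
  by rewrite -xy; exact: closure_orbit_refl.
have /orbit_closure_sub : closure (tg_orbit a x) y.
  by rewrite xy; exact: closure_orbit_refl.
by move=> [/orbit_eqP //|->] [/orbit_eqP //|->].
Qed.

Lemma nonminimal_closure_particular {x : X} :
  ~ minimal_point a x -> closure (tg_orbit a x) b.
Proof.
move=> /contrapT [Z [[y Zy] cZ iZ [Zx nxZ]]].
have [xy|<-] := orbit_closure_sub _ (Zx _ Zy); last exact: Zx.
by case: nxZ; exact: closure_orbit_sub_closed Zy xy.
Qed.

(** The least open neighborhood of the point of a non-minimal [xS] consists of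
    that point and the point of [bS]: every element of the closure of [xS]
    other than [b] lies in [xS] itself. *)
Lemma open_indicatorE (U : set (indicator_space a)) :
  open U <-> forall x, ~ minimal_point a x ->
                       U (orbit_point a x) -> U (orbit_point a b).
Proof.
split=> [/open_indicator_basicP Usub x /nonminimal_closure_particular xb Ux|Ub].
  by apply: Usub Ux _ _; exists b.
apply/open_indicator_basicP => x Ux p [y xy py].
have {py} -> : p = orbit_point a y by exact: val_inj.
have [xm|xnm] := pselect (minimal_point a x).
  by rewrite (_ : orbit_point a y = orbit_point a x) //; apply: val_inj;
    exact: minimal_closure_orbit.
have [/orbit_eqP yx|->] := orbit_closure_sub _ xy; last exact: Ub Ux.
by rewrite -(orbit_point_eq.2 yx).
Qed.

End Fort.

(** * The indicator space of a Fort transformation group *)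

Theorem theorem3p4 (X : topologicalType) (b : X) (S : groupType)
    (a : transformation_group X S) (alpha beta : cardinal) :
  Fort_space b ->
  [set: alpha] #=
    [set tg_orbit a x | x in [set x | minimal_point a x]] `\ tg_orbit a b ->
  [set: beta] #=
    [set tg_orbit a x | x in [set x | ~ minimal_point a x]] `|` [set tg_orbit a b] ->
  homeomorphic (indicator_space a)
    (topological_sum (cardinal_discrete alpha) (cardinal_particular beta)).
Proof.
move=> Xb alphaE betaE.
pose O x := tg_orbit a x; pose pt x := orbit_point a x.
have alphaO : [set: alpha] #= O @` [set x | minimal_point a x /\ O x <> O b].
  rewrite [X in _ #= X](_ : _ = (O @` (minimal_point a)) `\ O b) //.
  apply/seteqP; split => [_ [x [xm xb] <-]|_ [[x xm <-] xb]].
    by split => //; exists x.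
  by exists x.
have betaO : [set: beta] #= O @` [set x | ~ minimal_point a x \/ x = b].
  by rewrite image_setU image_set1.
have [r [rP rinj rsurj]] := card_eq_image_reps alphaO.
(* [beta] is not empty, because [bS] belongs to the second set of orbits. *)
have [z z0] : exists z : beta, is_zero z.
  have [r' [_ _ r'surj]] := card_eq_image_reps betaO.
  by have [j _] := r'surj b (or_intror erefl); exact: ex_zero j.
have [q [qP qinj qsurj qz]] :=
  card_eq_image_reps_at (z := z) (or_intror (erefl b)) betaO.
pose Q (i : bool) : topologicalType :=
  if i then cardinal_discrete alpha else cardinal_particular beta.
pose rep i : Q i -> X := if i return Q i -> X then r else q.
pose e (p : {i & Q i}) : indicator_space a := pt (rep (projT1 p) (projT2 p)).
have ptE x y : pt x = pt y <-> O x = O y by exact: orbit_point_eq.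
(* Minimality depends only on the orbit, so the two families could only meet at
   the orbit of [b], which the first one omits. *)
have rq i j : O (r i) <> O (q j).
  have [rm rb] := rP i => rqE.
  have [qnm|qb] := qP j; first exact/qnm/(minimal_point_orbit a rqE).
  by apply: rb; rewrite rqE qb.
apply: (@homeomorphic_from_bij _ {i & Q i} e).
  have einj : injective e.
    move=> [[] i] [[] j] /ptE /=.
    - by move=> /rinj ->.
    - by move=> /rq.
    - by move=> /esym /rq.
    - by move=> /qinj ->.
  have esurj p : exists u, e u = p.
    have [x ->] := orbit_point_surj a p.
    have [[xm xb]|] := pselect (minimal_point a x /\ O x <> O b).
      have [i ri] := rsurj x (conj xm xb).
      by exists (existT Q true i); apply/ptE.
    move=> /not_andP [xnm|/contrapT xb].
      have [j qj] := qsurj x (or_introl xnm).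
      by exists (existT Q false j); apply/ptE.
    by exists (existT Q false z); apply/ptE; rewrite /= qz.
  have [g gK] := choice esurj.
  by exists g => // u; apply: einj; rewrite gK.
have ez : e (existT Q false z) = pt b by exact/ptE.
move=> U; rewrite (open_indicatorE a Xb) sigT_openP.
split=> [Ub [|]|oU x xnm Ux].
- exact: discrete_open.
(* If the trace of [U] on the second summand is not empty, it contains [0]: a
   non-minimal orbit in [U] forces [bS] into [U]. *)
- have [[j Uj]|nU] := pselect (exists j, U (e (existT Q false j))).
    left; exists z => //=; rewrite /preimage /= ez.
    have [qnm|qb] := qP j; first exact: Ub qnm Uj.
    by rewrite -qb.
  by right; apply/seteqP; split => // j Uj; apply: nU; exists j.
(* Conversely a non-minimal orbit in [U] makes this trace nonempty, so that,
   being open, it contains [0]. *)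
- have [j qj] := qsurj x (or_introl xnm).
  have Uj : U (e (existT Q false j)).
    by rewrite (_ : e _ = pt x) //; apply/ptE.
  have [[z' z'0 Uz]|/seteqP [/(_ j Uj) //]] := oU false.
  by rewrite -[orbit_point a b]ez (is_zero_uniq z0 z'0).
Qed.
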